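(* Let $N$ be a network, let ${\cal P}$ be any protocol over $N$, and let $A$, $B$, $G\subseteq Ch(N)$ be sets of channels such that $G$ is a gateway between $A$ and $B$ in $N$. If $A$ functionally determines $B$ with respect to ${\cal P}$, then $G$ functionally determines $B$ with respect to ${\cal P}$.
   Context: A network $N$ is a finite undirected graph (loops and multiple edges allowed) whose vertices are called parties and whose edges are called channels; $Ch(N)$ is the set of channels, and for a party $p$, $Inc(p)$ is the set of channels incident with $p$. A semi-protocol over $N$ assigns to each channel $c$ an arbitrary set $V(c)$ of values and to each party $p$ a predicate $L_p$ on $\prod_{c\in Inc(p)}V(c)$. A run is a function $r$ with $r(c)\in V(c)$ for all $c\in Ch(N)$ such that $L_p$ holds of $(r(c))_{c\in Inc(p)}$ for every party $p$. A protocol is a semi-protocol having at least one run; ${\cal R}({\cal P})$ is its set of runs. For a set $X$ of channels write $r\equiv_X r'$ if $r(c)=r'(c)$ for all $c\in X$. A set of channels $A$ functionally determines a set of channels $B$ with respect to ${\cal P}$ if for all $r,r'\in{\cal R}({\cal P})$, $r\equiv_A r'$ implies $r\equiv_B r'$. A path is a sequence of channels $(c_1,\dots,c_n)$ forming an undirected walk in the graph (consecutive channels share a party). A set $G$ of channels is a gateway between sets $A$ and $B$ if every path $(c_1,\dots,c_n)$ with $c_1\in A$ and $c_n\in B$ has $c_i\in G$ for some $i$ (the sets $A,B,G$ need not be disjoint). *)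

(* Defs.v *)
From mathcomp Require Import all_boot.

Set Implicit Arguments.
Unset Strict Implicit.
Unset Printing Implicit Defensive.

(* A finite undirected multigraph. The unordered pair of ends of a channel is
   its set of ends, which is a singleton exactly when the channel is a loop;
   distinct channels may have the same ends. *)
Record network := Network {
  party : finType;
  channel : finType;
  ends : channel -> {set party};
  ends_card : forall c, 0 < #|ends c| <= 2
}.

Definition Inc (N : network) (p : party N) : {set channel N} :=
  [set c | p \in ends c].

Record semi_protocol (N : network) := SemiProtocol {
  value : channel N -> Type;
  local : forall p : party N,
    (forall c : {c : channel N | c \in Inc p}, value (val c)) -> Prop
}.

Definition assignment (N : network) (S : semi_protocol N) :=
  forall c : channel N, value S c.

Definition is_run (N : network) (S : semi_protocol N) (r : assignment S) :=
  forall p : party N,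
    @local N S p (fun c : {c : channel N | c \in Inc p} => r (val c)).

Record protocol (N : network) := Protocol {
  semi_protocol_of :> semi_protocol N;
  has_run : exists r : assignment semi_protocol_of, is_run r
}.

Definition agree_on (N : network) (S : semi_protocol N) (X : {set channel N})
    (r r' : assignment S) :=
  forall c, c \in X -> r c = r' c.

Definition functionally_determines (N : network) (P : protocol N)
    (A B : {set channel N}) :=
  forall r r' : assignment P, is_run r -> is_run r' ->
    agree_on A r r' -> agree_on B r r'.

(* [walk_from u [:: c1; ..; cn]]: there are parties u = v0, v1, .., vn such
   that the ends of each ci are v(i-1) and vi (equal ones if ci is a loop). *)
Fixpoint walk_from (N : network) (u : party N) (s : seq (channel N)) : Prop :=
  if s is c :: s' then
    exists2 v : party N, ends c = [set u; v] & walk_from v s'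
  else True.

Definition is_path (N : network) (s : seq (channel N)) :=
  exists u : party N, walk_from u s.

(* The paths (c1, .., cn) considered here have n >= 1; n = 1 is allowed, so a
   gateway between A and B contains A :&: B. *)
Definition gateway (N : network) (G A B : {set channel N}) :=
  forall (c : channel N) (s : seq (channel N)),
    is_path (c :: s) -> c \in A -> last c s \in B ->
    exists2 d : channel N, d \in c :: s & d \in G.

(* Main.v *)
Require Import Defs.
From mathcomp Require Import all_boot.
From Stdlib Require Import FunctionalExtensionality.

(** Let [r] and [r'] be runs that agree on [G], and let [C] be the set of
    channels joined to [B] by a path avoiding [G]. Use [r'] on [C] and [r]
    elsewhere. A party incident with a channel in [C] has all its channels in
    [C] or [G], so every party sees either [r] or [r'] and the splice is a run.
    It agrees with [r] on [A], which is disjoint from [C], hence on [B]; but on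
    [B] outside [G] it is [r']. *)

Lemma ends_set2 (N : network) (c : channel N) (p : party N) :
  p \in ends c -> exists q, ends c = [set q; p].
Proof.
move=> pc; have /andP[_ card_le2] := ends_card c.
have : #|ends c :\ p| <= 1 by move: card_le2; rewrite (cardsD1 p) pc.
have endsE : ends c = p |: (ends c :\ p) by rewrite setD1K.
rewrite leq_eqVlt ltnS leqn0 cards_eq0 => /orP[/cards1P[q def_q] | /eqP rest0].
  by exists q; rewrite endsE def_q setUC.
by exists p; rewrite endsE rest0 setU0 setUid.
Qed.

Definition adjacent_outside (N : network) (G : {set channel N}) :=
  [rel c d : channel N |
    [&& c \notin G, d \notin G & [exists p, (p \in ends c) && (p \in ends d)]]].

(* A [path] for adjacency may use one party several times in a row, as in a
   star, so it is not itself a walk: when the new channel [d] meets the far end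
   of the first channel [c] of the walk, [d] replaces [c]. *)
Lemma adjacent_path_walk (N : network) (G : {set channel N})
    (d : channel N) (s : seq (channel N)) :
  d \notin G -> path (adjacent_outside N G) d s ->
  exists t, [/\ is_path (d :: t), last d t = last d s
              & all [predC G] (d :: t)].
Proof.
elim: s d => [|c s IHs] d dG /=.
  move=> _; exists [::]; split=> //=; last by rewrite dG.
  have /card_gt0P[p /ends_set2[q dE]] : 0 < #|ends d|.
    by case/andP: (ends_card d).
  by exists q, p.
case/andP=> /and3P[_ cG /existsP[p /andP[pd pc]]].
case/(IHs c cG)=> t [[u [v cE walk_t]] <- /= /andP[_ tG]].
have [w dE] := ends_set2 _ _ _ pd.
(* [keep] puts [d] in front of [c], which works once the walk can leave [p] through [c]. *)
have keep : walk_from p (c :: t) -> exists t',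
    [/\ is_path (d :: t'), last d t' = last c t & all [predC G] (d :: t')].
  move=> walk_ct; exists (c :: t); split=> //=; last by rewrite dG cG.
  by exists w, p.
move: (pc); rewrite cE => /set2P[] def_p; first by apply: keep; exists v; rewrite ?def_p.
(* Now [p] is the far end [v]. If [c] is the only channel, it must stay as the last one and is
   traversed backwards; otherwise the walk goes on from [p] and [d] replaces [c]. *)
case: t walk_t tG keep => [|a t] walk_t tG keep.
  by apply: keep; exists u; rewrite // cE def_p setUC.
exists (a :: t); split=> //=; last by rewrite dG.
by exists w, p; rewrite // def_p.
Qed.

Definition joined_outside (N : network) (G B : {set channel N}) :
    {set channel N} :=
  [set c | (c \notin G) && [exists b in B, connect (adjacent_outside N G) c b]].

Lemma gateway_joined_outside (N : network) (G A B : {set channel N})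
    (c : channel N) :
  gateway G A B -> c \in A -> c \notin joined_outside N G B.
Proof.
move=> gate cA; apply/negP; rewrite inE.
case/andP=> cG /exists_inP[b bB /connectP[s adj_s def_b]].
have [t [path_t last_t /allP tG]] := adjacent_path_walk _ _ _ _ cG adj_s.
have lastB : last c t \in B by rewrite last_t -def_b.
have [e et eG] := gate c t path_t cA lastB.
by have := tG e et; rewrite /= eG.
Qed.

Lemma joined_outside_step (N : network) (G B : {set channel N})
    (p : party N) (c d : channel N) :
  c \in Inc p -> d \in Inc p -> c \in joined_outside N G B -> d \notin G ->
  d \in joined_outside N G B.
Proof.
rewrite [c \in Inc p]inE [d \in Inc p]inE [c \in _]inE [d \in joined_outside _ _ _]inE.
move=> pc pd /andP[cG /exists_inP[b bB c_b]] dG; rewrite dG.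
apply/exists_inP; exists b => //; apply: connect_trans c_b; apply: connect1.
by rewrite /= dG cG; apply/existsP; exists p; rewrite pd pc.
Qed.

Lemma local_agree (N : network) (S : semi_protocol N) (p : party N)
    (r r' : assignment S) :
  agree_on (Inc p) r r' ->
  @local N S p (fun c : {c : channel N | c \in Inc p} => r (val c)) ->
  @local N S p (fun c : {c : channel N | c \in Inc p} => r' (val c)).
Proof.
move=> rr'; congr (@local N S p _).
by apply: functional_extensionality_dep => c; apply/rr'/valP.
Qed.

Definition splice (N : network) (S : semi_protocol N) (C : {set channel N})
    (r r' : assignment S) : assignment S :=
  fun c => if c \in C then r' c else r c.

Lemma splice_run (N : network) (S : semi_protocol N) (G B : {set channel N})
    (r r' : assignment S) :
  is_run r -> is_run r' -> agree_on G r r' ->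
  is_run (splice N S (joined_outside N G B) r r').
Proof.
move=> run_r run_r' rr' p.
have [/exists_inP[c pc cC] | noC] :=
  boolP [exists c in Inc p, c \in joined_outside N G B].
  apply: local_agree (run_r' p) => d pd; rewrite /splice.
  (* A channel of [p] where the splice still uses [r] must lie in [G], and there the two runs
     agree. *)
  case: ifPn => // dC; have [/rr' // | dG] := boolP (d \in G).
  by rewrite (joined_outside_step _ _ _ _ _ _ pc pd cC dG) in dC.
apply: local_agree (run_r p) => d pd; rewrite /splice.
by case: ifPn => // dC; case/exists_inP: noC; exists d.
Qed.

Theorem theorem4 (N : network) (P : protocol N) (A B G : {set channel N}) :
  gateway G A B ->
  functionally_determines P A B ->
  functionally_determines P G B.
Proof.
move=> gate detAB r r' run_r run_r' rr' b bB.
have [/rr' // | bG] := boolP (b \in G).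
have run_s := splice_run N P G B r r' run_r run_r' rr'.
have -> := detAB _ _ run_r run_s _ b bB.
  (* The one-channel path joins [b] to itself outside [G], so the splice takes the value of [r'] at
     [b]. *)
  rewrite /splice inE bG; case: exists_inP => // [[]].
  by exists b => //; exact: connect0.
by move=> a aA; rewrite /splice (negPf (gateway_joined_outside _ _ _ _ _ gate aA)).
Qed.
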